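(* Let $\varrho>0$ be real, $n\geq 2$ an integer and $f\in C[0,1]$. Then $$\lim_{M\to\infty}\left(1-\lambda_{\varrho,n}^{(n)}\right)^{-M}\left(\oplus^M U_n^{\varrho}f-L_n^{\varrho}f\right)=-[F_{n,0}^{\varrho},F_{n,1}^{\varrho},\dots,F_{n,n}^{\varrho};f]\;p_{\varrho,n}^{(n)},$$ uniformly on $[0,1]$, where $\oplus^M U_n^{\varrho}=I-(I-U_n^{\varrho})^M$ is the $M$-fold iterated Boolean sum of $U_n^{\varrho}$.
   Context: $\Pi_n$ denotes the space of real polynomials of degree at most $n$ (viewed as functions on $[0,1]$), $B(\cdot,\cdot)$ is the Euler Beta function, $e_j(x)=x^j$, and $I$ is the identity operator on $C[0,1]$. For real $\varrho>0$ and an integer $n\geq 1$, define functionals $F_{n,k}^{\varrho}:C[0,1]\to\mathbb{R}$, $k=0,\dots,n$, by $$F_{n,0}^{\varrho}(f)=f(0),\quad F_{n,n}^{\varrho}(f)=f(1),\quad F_{n,k}^{\varrho}(f)=\int_0^1\frac{t^{k\varrho-1}(1-t)^{(n-k)\varrho-1}}{B(k\varrho,(n-k)\varrho)}f(t)\,dt,\ 1\leq k\leq n-1.$$ The operator $U_n^{\varrho}:C[0,1]\to\Pi_n\subset C[0,1]$ is $U_n^{\varrho}(f;x)=\sum_{k=0}^n F_{n,k}^{\varrho}(f)\,p_{n,k}(x)$, with $p_{n,k}(x)=\binom nk x^k(1-x)^{n-k}$. The restriction $U_n^{\varrho}|_{\Pi_n}:\Pi_n\to\Pi_n$ has eigenvalues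 (counted with multiplicity) $1=\lambda_{\varrho,0}^{(n)}=\lambda_{\varrho,1}^{(n)}>\lambda_{\varrho,2}^{(n)}>\dots>\lambda_{\varrho,n}^{(n)}>0$, so it is invertible. For $n\ge 2$, $\lambda_{\varrho,n}^{(n)}$ is thus its smallest eigenvalue, which is simple, and $p_{\varrho,n}^{(n)}$ denotes the corresponding eigenpolynomial, which has degree $n$ and is normalized to be monic. The operator $L_n^{\varrho}:C[0,1]\to\Pi_n$ is defined by $L_n^{\varrho}=(U_n^{\varrho}|_{\Pi_n})^{-1}\circ U_n^{\varrho}$. Equivalently, $L_n^{\varrho}f$ is the unique polynomial in $\Pi_n$ with $F_{n,k}^{\varrho}(L_n^{\varrho}f)=F_{n,k}^{\varrho}(f)$ for $k=0,\dots,n$. The generalized divided difference $[F_{n,0}^{\varrho},F_{n,1}^{\varrho},\dots,F_{n,n}^{\varrho};f]$ is defined as the coefficient of $e_n$ in $L_n^{\varrho}f$. *)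

(* Defs.v *)
From HB Require Import structures.
From mathcomp Require Import all_boot all_order all_algebra.
From mathcomp Require Import all_classical all_reals all_analysis.
Set Implicit Arguments.
Unset Strict Implicit.
Unset Printing Implicit Defensive.
Import Order.TTheory GRing.Theory Num.Theory.
Import numFieldNormedType.Exports.
Local Open Scope classical_set_scope.
Local Open Scope ring_scope.

(* MathComp-Analysis.  A function in C[0,1] is a map f : R -> R with
   {within `[0, 1], continuous f}; its values outside [0,1] are never used.
   The space Pi_n is {poly_n.+1 R}, since {poly_m R} bounds the size,
   i.e. degree + 1, by m. *)

Section UOperator.
Context {R : realType}.

(* The library's beta_fun only takes natural number arguments. *)
Definition eulerB (a b : R) : R :=
  \int[lebesgue_measure]_(t in `[0, 1]) (t `^ (a - 1) * (1 - t) `^ (b - 1)).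

Definition Ffun (n : nat) (rho : R) (k : nat) (f : R -> R) : R :=
  if k == 0%N then f 0
  else if k == n then f 1
  else \int[lebesgue_measure]_(t in `[0, 1])
         (t `^ (k%:R * rho - 1) * (1 - t) `^ ((n - k)%:R * rho - 1)
          / eulerB (k%:R * rho) ((n - k)%:R * rho) * f t).

Definition bern (n k : nat) : {poly R} :=
  'C(n, k)%:R *: ('X ^+ k * (1 - 'X) ^+ (n - k)).

Lemma size_bern n k : (k <= n)%N -> (size (bern n k) <= n.+1)%N.
Proof.
move=> kn; apply: leq_trans (size_scale_leq _ _) _.
apply: leq_trans (size_polyMleq _ _) _; rewrite size_polyXn addSn /=.
rewrite -[in leqRHS](subnKC kn) -addnS leq_add2l.
rewrite -opprB exprNn -signr_odd mulr_sign.
by case: ifP => _; rewrite ?size_polyN (size_exp_XsubC (n - k) 1).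
Qed.

(* npolyp only changes the type here: see UopE. *)
Definition Uop (n : nat) (rho : R) (f : R -> R) : {poly_n.+1 R} :=
  npolyp n.+1 (\sum_(k < n.+1) Ffun n rho k f *: bern n k).

Lemma UopE n rho f :
  Uop n rho f = \sum_(k < n.+1) Ffun n rho k f *: bern n k :> {poly R}.
Proof.
rewrite npolypK// (leq_trans (size_sum _ _ _))//; apply/bigmax_leqP => k _.
by rewrite (leq_trans (size_scale_leq _ _))// size_bern// -ltnS.
Qed.

(* The restriction of U_n^rho to Pi_n, as an endomorphism; linfun agrees with its
   argument because Uop is linear on continuous functions when 0 < rho. *)
Definition UPi (n : nat) (rho : R) : 'End({poly_n.+1 R}) :=
  linfun (fun p : {poly_n.+1 R} => Uop n rho (horner p)).

(* The matrix of UPi in the monomial basis (acting on row vectors). *)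
Definition UPi_mx (n : nat) (rho : R) : 'M[R]_n.+1 :=
  \matrix_(i, j) coord (npolyX R n.+1) j (UPi n rho (tnth (npolyX R n.+1) i)).

(* The eigenvalues of UPi, repeated according to their algebraic multiplicity
   and listed in nonincreasing order. *)
Definition eigvals (n : nat) (rho : R) : seq R :=
  xget [::] [set s : seq R | sorted >=%R s /\
    char_poly (UPi_mx n rho) = \prod_(a <- s) ('X - a%:P)].

Definition lambda (n : nat) (rho : R) (j : nat) : R := (eigvals n rho)`_j.

(* The monic eigenpolynomial for lambda n rho n (unique as this eigenvalue is
   simple). *)
Definition eigpoly (n : nat) (rho : R) : {poly_n.+1 R} :=
  xget 0 [set p : {poly_n.+1 R} |
    p \in passmx.leigenspace (UPi n rho) (lambda n rho n) /\ (p : {poly R}) \is monic].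

Definition Lop (n : nat) (rho : R) (f : R -> R) : {poly_n.+1 R} :=
  ((UPi n rho)^-1)%VF (Uop n rho f).

Definition divdiff (n : nat) (rho : R) (f : R -> R) : R := (Lop n rho f)`_n.

(* I - (I - T)^M *)
Definition boolean_sum (M : nat) (T : (R -> R) -> (R -> R)) (f : R -> R) :
    R -> R :=
  fun x => f x - iter M (fun g y => g y - T g y) f x.

End UOperator.

(* Main.v *)
(* U_n^rho maps e_d to l_d e_d plus terms of lower degree, because F_{n,k}(e_d)
   is a quotient of rising factorials of k rho and n rho and
   sum_k (k rho)^(rising d) p_{n,k} obeys a first-order recursion in d. Hence
   Pi_n has a basis of eigenpolynomials p_d, with
   l_0 = l_1 = 1 > l_2 > ... > l_n > 0. As U (f - L f) = 0, the Boolean sum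
   minus L f equals -(I - U)^M (L f); expanding L f in the eigenbasis and
   dividing by (1 - l_n)^M, only the p_n component survives. Since p_n is monic,
   its coefficient is that of e_n in L f. *)
From HB Require Import structures.
Require Import Defs.
From mathcomp Require Import all_boot all_order all_algebra.
From mathcomp Require Import all_classical all_reals all_analysis.
From mathcomp Require Import measurable_realfun ring lra.
Set Implicit Arguments.
Unset Strict Implicit.
Unset Printing Implicit Defensive.
Import Order.TTheory GRing.Theory Num.Theory.
Import numFieldNormedType.Exports.
Local Open Scope classical_set_scope.
Local Open Scope ring_scope.

(** * Fundamental theorem of calculus for integrands singular at the end points *)

Lemma itvoo_bigcup_itvcc (R : realType) (a b : R) : a < b ->
  \bigcup_k `[a + (b - a) / k.+3%:R, b - (b - a) / k.+3%:R]%classic =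
  `]a, b[%classic.
Proof.
move=> ab; have ba : 0 < b - a by rewrite subr_gt0.
have h k : 0 < (b - a) / k.+3%:R :> R by rewrite divr_gt0.
apply/seteqP; split => [x [k _]|x] /=; rewrite !in_itv/=.
  by move: (h k); set e := _ / _ => e0 /andP[ax xb]; apply/andP; split; lra.
move=> /andP[ax xb].
pose e := Num.min (x - a) (b - x).
have e0 : 0 < e by rewrite lt_min !subr_gt0 ax xb.
(* With k the truncation of (b - a) / e, this quotient is below k + 1, hence below k + 3. *)
have hk : (b - a) / (Num.trunc ((b - a) / e)).+3%:R <= e.
  rewrite ler_pdivrMr// mulrC -ler_pdivrMr//.
  have /ltW/le_trans := truncnS_gt ((b - a) / e).
  by apply; rewrite ler_nat ltnW.
exists (Num.trunc ((b - a) / e)) => //=.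
move: hk; rewrite /e le_min in_itv/=; set u := _ / _ => /andP[? ?].
by apply/andP; split; lra.
Qed.

(** Here [f] may blow up at [a] and [b]. The usual theorem applies on closed subintervals exhausting
    the open one; monotone convergence, where the sign of [f] enters, handles the integrals, and
    one-sided continuity of [F] handles the increments. *)
Lemma ge0_FTC2_itvoo (R : realType) (f F : R -> R) (a b : R) : a < b ->
  {in `]a, b[, forall x, 0 <= f x} ->
  {in `]a, b[, continuous f} ->
  derivable_oo_LRcontinuous F a b ->
  {in `]a, b[, (F^`())%classic =1 f} ->
  (\int[lebesgue_measure]_(x in `[a, b]) (f x)%:E = (F b)%:E - (F a)%:E)%E.
Proof.
move=> ab f0 cf [dF Fa Fb] dFE.
pose h k : R := (b - a) / k.+3%:R.
have ba : 0 < b - a by rewrite subr_gt0.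
have h0 k : 0 < h k by rewrite divr_gt0.
(* A margin of at most a third of the length keeps every [S k] nondegenerate. *)
have hle k : h k <= (b - a) / 3.
  by rewrite ler_pM2l// lef_pV2 ?posrE// ler_nat.
have hS k : h k.+1 <= h k by rewrite ler_pM2l// lef_pV2 ?posrE// ler_nat.
have h_cvg : h @ \oo --> 0.
  rewrite -(mulr0 (b - a)); apply: cvgMl_tmp.
  have := @cvg_harmonic R; rewrite -(cvg_shiftn 2) /=.
  by under eq_fun do rewrite /= addn2.
pose S k := `[a + h k, b - h k]%classic.
have Soo k : S k `<=` `]a, b[%classic.
  move=> x; rewrite /S/= !in_itv/= => /andP[? ?]; have ? := h0 k.
  by apply/andP; split; lra.
have mf : measurable_fun `]a, b[ f.
  apply: open_continuous_measurable_fun; first exact: interval_open.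
  by move=> x; rewrite inE; exact: cf.
have mEf : measurable_fun `]a, b[ (EFin \o f) by exact/measurable_EFinP.
rewrite (integral_itv_bndoo true false mEf) -(itvoo_bigcup_itvcc ab).
have int_cvg : ((\int[lebesgue_measure]_(x in S k) (f x)%:E)%E @[k --> \oo]
    --> (\int[lebesgue_measure]_(x in \bigcup_i S i) (f x)%:E)%E).
  apply: (@ge0_nondecreasing_set_cvg_integral _ (measurableTypeR R) R S (EFin \o f)).
  - apply/nondecreasing_seqP => k; apply/subsetPset => x.
    rewrite /S/= !in_itv/= => /andP[? ?]; have ? := hS k.
    by apply/andP; split; lra.
  - by move=> k; exact: measurable_itv.
  - by move=> k; apply: measurable_funS mEf => //; exact: Soo.
  - by move=> k x /Soo xab; rewrite lee_fin f0.
have int_S k : (\int[lebesgue_measure]_(x in S k) (f x)%:E)%E =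
    (F (b - h k) - F (a + h k))%:E.
  have lt_k : a + h k < b - h k by have := hle k; lra.
  rewrite EFinB; apply: continuous_FTC2 => //.
  - apply: continuous_in_subspaceT => x; rewrite inE => /Soo; exact: cf.
  - have cF x : x \in `]a, b[ -> {for x, continuous F}.
      by move=> /dF xab; apply: differentiable_continuous; exact/derivable1_diffP.
    have l_in : a + h k \in `]a, b[.
      by rewrite in_itv/= ltrDl h0 (lt_trans lt_k) ?ltrDl ?ltrBlDr ?ltrDl ?h0.
    have r_in : b - h k \in `]a, b[.
      by rewrite in_itv/= (lt_trans _ lt_k) ?ltrDl ?ltrBlDr ?ltrDl ?h0.
    split.
    + by move=> x xS; apply: dF; apply: (Soo k); exact: subset_itv_oo_cc xS.
    + by apply: cvg_at_right_filter; exact: cF.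
    + by apply: cvg_at_left_filter; exact: cF.
  - by move=> x xS; apply: dFE; apply: (Soo k); exact: subset_itv_oo_cc xS.
rewrite (eq_cvg _ _ int_S) in int_cvg.
apply: cvg_unique int_cvg _ => //.
rewrite -EFinB; apply: cvg_EFin; first exact: nearW.
apply: cvgB.
- apply: ((cvg_at_leftP F _ _).1 Fb); split => [k|].
    by rewrite ltrBlDr ltrDl h0.
  by rewrite -[X in _ --> X]subr0; apply: cvgB => //; exact: cvg_cst.
- apply: ((cvg_at_rightP F _ _).1 Fa); split => [k|].
    by rewrite ltrDl h0.
  by rewrite -[X in _ --> X]addr0; apply: cvgD => //; exact: cvg_cst.
Qed.

(** A nonnegative function with finite integral is integrable, so the antiderivative yields
    integrability as well as the value. *)
Lemma ge0_FTC2_integrable (R : realType) (f F : R -> R) (a b : R) : a < b ->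
  measurable_fun `[a, b] f ->
  {in `[a, b], forall x, 0 <= f x} ->
  {in `]a, b[, continuous f} ->
  derivable_oo_LRcontinuous F a b ->
  {in `]a, b[, (F^`())%classic =1 f} ->
  lebesgue_measure.-integrable `[a, b] (EFin \o f) /\
  \int[lebesgue_measure]_(x in `[a, b]) f x = F b - F a.
Proof.
move=> ab mf f0 cf dF dFE.
have intf : (\int[lebesgue_measure]_(x in `[a, b]) (f x)%:E =
             (F b)%:E - (F a)%:E)%E.
  by apply: ge0_FTC2_itvoo => // x xab; apply: f0; exact: subset_itv_oo_cc xab.
split; last by rewrite /Rintegral intf.
apply/integrableP; split; first exact/measurable_EFinP.
under eq_integral.
  by move=> x; rewrite inE/= => xab; rewrite ger0_norm ?f0//; over.
by rewrite intf ltry.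
Qed.

(** * Real powers of t and 1 - t on [0,1] *)

Section powR_itv.
Variable R : realType.
Implicit Types a b t : R.

Lemma onem_cvg_at_left1 : (1 - t : R) @[t --> (1 : R)^'-] --> (0 : R)^'+.
Proof.
move=> P [e /= e0 eP]; exists e => //= t /=; rewrite distrC => t1e t1.
apply: eP => /=; last by rewrite subr_gt0.
by rewrite sub0r normrN distrC.
Qed.

Lemma powR_onem_cvg1 b : 0 < b -> (1 - t) `^ b @[t --> (1 : R)^'-] --> (0 : R).
Proof. by move=> b0; apply: cvg_comp onem_cvg_at_left1 (powR_cvg0 b0). Qed.

Lemma is_derive_powR_onem b t : t < 1 ->
  is_derive t 1 (fun u => (1 - u) `^ b) (- (b * (1 - t) `^ (b - 1))).
Proof.
move=> t1; have t0 : 0 < 1 - t by rewrite subr_gt0.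
have dpow := is_derive1_powR b t0.
have donem : is_derive t 1 (fun u : R => 1 - u) (-1).
  by apply: is_derive_eq; rewrite add0r mul1r.
apply: is_derive_eq.
  by apply: (@is_derive1_comp _ (@powR R ^~ b) (fun u => 1 - u) t _ _ dpow donem).
by rewrite mulrN1.
Qed.

Lemma powR_continuous_at a t : 0 < t -> {for t, continuous (@powR R ^~ a)}.
Proof.
move=> t0; apply: differentiable_continuous; apply/derivable1_diffP.
by have [] := is_derive1_powR a t0.
Qed.

Lemma powR_onem_continuous_at b t :
  t < 1 -> {for t, continuous (fun u : R => (1 - u) `^ b)}.
Proof.
move=> t1; apply: differentiable_continuous; apply/derivable1_diffP.
by have [] := is_derive_powR_onem b t1.
Qed.

Lemma measurable_powR_onem (D : set R) b :
  measurable_fun D (fun t => (1 - t) `^ b).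
Proof.
apply: measurable_funTS.
apply: (measurableT_comp (f := @powR R ^~ b) (g := fun t => 1 - t)).
  exact: measurable_powR.
exact: measurable_funB.
Qed.

(** The antiderivative -(1 - t)^b is continuous up to t = 1 because b > 0, even when the integrand
    is unbounded there. *)
Lemma powR_onem_integral b : 0 < b ->
  lebesgue_measure.-integrable `[0, 1]
    (EFin \o (fun t : R => b * (1 - t) `^ (b - 1))) /\
  \int[lebesgue_measure]_(t in `[0, 1]) (b * (1 - t) `^ (b - 1)) = 1.
Proof.
move=> b0.
have [|||||iw ->] := @ge0_FTC2_integrable R (fun t => b * (1 - t) `^ (b - 1))
    (fun t => - (1 - t) `^ b) 0 1 ltr01.
- by apply: measurable_funM => //; exact: measurable_powR_onem.
- by move=> t _; rewrite mulr_ge0 ?powR_ge0// ltW.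
- move=> t; rewrite in_itv/= => /andP[_ t1].
  by apply: cvgM; [exact: cvg_cst|exact: powR_onem_continuous_at].
- split.
  + move=> t; rewrite in_itv/= => /andP[_ t1]; apply: derivableN.
    by have [] := is_derive_powR_onem b t1.
  + apply: cvgN; apply: cvg_at_right_filter.
    exact: powR_onem_continuous_at.
  + by apply: cvgN; rewrite subrr powR0 ?gt_eqF//; exact: powR_onem_cvg1.
- move=> t; rewrite in_itv/= => /andP[_ t1]; rewrite derive1E.
  by have [dw dE] := is_derive_powR_onem b t1; rewrite deriveN// dE opprK.
by split=> //; rewrite subrr subr0 powR1 powR0 ?gt_eqF// oppr0 sub0r opprK.
Qed.

Lemma powR_integrable a : 0 < a ->
  lebesgue_measure.-integrable `[0, 1] (EFin \o (fun t : R => a * t `^ (a - 1))).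
Proof.
move=> a0.
have [//|||||//] := @ge0_FTC2_integrable R (fun t => a * t `^ (a - 1))
    (@powR R ^~ a) 0 1 ltr01.
- apply: measurable_funM => //; apply: measurable_funTS; exact: measurable_powR.
- by move=> t _; rewrite mulr_ge0 ?powR_ge0// ltW.
- move=> t; rewrite in_itv/= => /andP[t0 _].
  by apply: cvgM; [exact: cvg_cst|exact: powR_continuous_at].
- split.
  + move=> t; rewrite in_itv/= => /andP[t0 _].
    by have [] := is_derive1_powR a t0.
  + by rewrite powR0 ?gt_eqF//; exact: powR_cvg0.
  + by apply: cvg_at_left_filter; exact: powR_continuous_at.
- move=> t; rewrite in_itv/= => /andP[t0 _]; rewrite derive1E.
  by have [] := is_derive1_powR a t0.
Qed.

End powR_itv.

(** * The Beta weight: integrability, first moment, positivity *)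

Section beta_weight.
Variable R : realType.
Implicit Types a b t : R.

Let m01 : measurable (`[0, 1]%classic : set (measurableTypeR R)).
Proof. exact: measurable_itv. Qed.

Definition beta_weight a b t : R := t `^ (a - 1) * (1 - t) `^ (b - 1).

Lemma measurable_beta_weight (D : set R) a b :
  measurable_fun D (beta_weight a b).
Proof.
apply: measurable_funM; last exact: measurable_powR_onem.
by apply: measurable_funTS; exact: measurable_powR.
Qed.

Lemma beta_weight_ge0 a b t : 0 <= beta_weight a b t.
Proof. by rewrite mulr_ge0 ?powR_ge0. Qed.

Lemma beta_weightX a b t : 0 < a -> 0 <= t ->
  t * beta_weight a b t = t `^ a * (1 - t) `^ (b - 1).
Proof. by move=> a0 t0; rewrite mulrA mulr_powRB1. Qed.

Lemma beta_weight_onem a b t : 0 < b -> t <= 1 ->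
  (1 - t) * beta_weight a b t = t `^ (a - 1) * (1 - t) `^ b.
Proof. by move=> b0 t1; rewrite mulrCA mulr_powRB1 ?subr_ge0. Qed.

Lemma powR_le1 a t : 0 <= a -> 0 <= t <= 1 -> t `^ a <= 1.
Proof.
move=> a0 /andP[t0 t1]; have <- : 1 `^ a = 1 :> R by rewrite powR1.
by rewrite ge0_ler_powR// nnegrE ler01.
Qed.

(** The factor t removes the singularity at 0: the product is t^a (1 - t)^(b-1), dominated by (1 -
    t)^(b-1). *)
Lemma beta_weightX_integrable a b : 0 < a -> 0 < b ->
  lebesgue_measure.-integrable `[0, 1] (EFin \o (fun t => t * beta_weight a b t)).
Proof.
move=> a0 b0; have [iw _] := powR_onem_integral b0.
have {}iw := integrableZl m01 (b^-1) iw.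
apply: le_integrable iw => //.
  apply/measurable_EFinP/measurable_funM => //; exact: measurable_beta_weight.
move=> t /=; rewrite in_itv/= => /andP[t0 t1].
rewrite lee_fin beta_weightX// mulKf ?gt_eqF//.
rewrite !ger0_norm ?mulr_ge0 ?powR_ge0//.
by rewrite ler_piMl ?powR_ge0// powR_le1 ?t0// ltW.
Qed.

Lemma beta_weight_onem_integrable a b : 0 < a -> 0 < b ->
  lebesgue_measure.-integrable `[0, 1]
    (EFin \o (fun t => (1 - t) * beta_weight a b t)).
Proof.
move=> a0 b0; have iw := powR_integrable a0.
have {}iw := integrableZl m01 (a^-1) iw.
apply: le_integrable iw => //.
  apply/measurable_EFinP/measurable_funM; last exact: measurable_beta_weight.
  exact: measurable_funB.
move=> t /=; rewrite in_itv/= => /andP[t0 t1].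
rewrite lee_fin beta_weight_onem// mulKf ?gt_eqF//.
rewrite !ger0_norm ?mulr_ge0 ?powR_ge0//.
by rewrite ler_piMr ?powR_ge0// powR_le1 ?subr_ge0 ?gerBl ?t1// ltW.
Qed.

(** Writing w = t w + (1 - t) w leaves a possible singularity at only one end in each summand. *)
Lemma beta_weight_integrable a b : 0 < a -> 0 < b ->
  lebesgue_measure.-integrable `[0, 1] (EFin \o beta_weight a b).
Proof.
move=> a0 b0.
have := integrableD m01 (beta_weightX_integrable a0 b0)
  (beta_weight_onem_integrable a0 b0).
apply: eq_integrable => // t _ /=.
by rewrite -EFinD -mulrDl addrC subrK mul1r.
Qed.

(* Integrate the derivative of t^a (1-t)^b over [0,1]. As it changes sign,
   b (1-t)^(b-1), which dominates its negative part and has integral 1, is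
   added to it first. *)
Lemma beta_weight_first_moment a b : 0 < a -> 0 < b ->
  (a + b) * \int[lebesgue_measure]_(t in `[0, 1]) (t * beta_weight a b t) =
  a * eulerB a b.
Proof.
move=> a0 b0.
pose w := beta_weight a b.
pose g t := b * (1 - t) `^ (b - 1).
have [ig int_g] := powR_onem_integral b0.
have iX := beta_weightX_integrable a0 b0.
have iw := beta_weight_integrable a0 b0.
pose f t := a * w t - (a + b) * (t * w t) + g t.
have iaw := integrableZl m01 a iw.
have iabX := integrableZl m01 (a + b) iX.
have iaB := integrableB m01 iaw iabX.
(* In this regrouping both summands are visibly nonnegative on [0,1], and it matches the derivative
   computed below. *)
have fE t : t \in `[0, 1] ->
    f t = a * (t `^ (a - 1) * (1 - t) `^ b) + b * (1 - t) `^ (b - 1) * (1 - t `^ a).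
  rewrite in_itv/= => /andP[t0 t1].
  rewrite /f /g -beta_weight_onem// -/w.
  have := beta_weightX b a0 t0; rewrite -/w => wX.
  transitivity (a * ((1 - t) * w t) + b * ((1 - t) `^ (b - 1) - t * w t)).
    by ring.
  by rewrite wX; ring.
have int_f : \int[lebesgue_measure]_(t in `[0, 1]) f t = 1.
  have [|||||_ ->] := @ge0_FTC2_integrable R f
    (fun t => t `^ a * (1 - t) `^ b - (1 - t) `^ b) 0 1 ltr01.
  - apply: measurable_funD.
      apply: measurable_funB; apply: measurable_funM => //.
        exact: measurable_beta_weight.
      by apply: measurable_funM => //; exact: measurable_beta_weight.
    by apply: measurable_funM => //; exact: measurable_powR_onem.
  - move=> t t01; rewrite fE//; move: t01; rewrite in_itv/= => /andP[t0 t1].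
    by rewrite addr_ge0 ?mulr_ge0 ?powR_ge0 ?subr_ge0 ?powR_le1 ?t0 ?t1// ltW.
  - move=> t; rewrite in_itv/= => /andP[t0 t1].
    have cw : {for t, continuous w}.
      apply: cvgM; first exact: powR_continuous_at.
      exact: powR_onem_continuous_at.
    apply: cvgD.
      apply: cvgB; apply: cvgM => //; try exact: cvg_cst.
      by apply: cvgM => //; exact: cvg_id.
    by apply: cvgM; [exact: cvg_cst|exact: powR_onem_continuous_at].
  - split.
    + move=> t; rewrite in_itv/= => /andP[t0 t1].
      have [d1 _] := is_derive1_powR a t0.
      have [d2 _] := is_derive_powR_onem b t1.
      by apply: derivableB => //; exact: derivableM.
    + apply: cvgB.
        apply: cvgM; first by rewrite powR0 ?gt_eqF//; exact: powR_cvg0.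
        by apply: cvg_at_right_filter; exact: powR_onem_continuous_at.
      by apply: cvg_at_right_filter; exact: powR_onem_continuous_at.
    + apply: cvgB.
        apply: cvgM.
          by apply: cvg_at_left_filter; exact: powR_continuous_at.
        by rewrite subrr powR0 ?gt_eqF//; exact: powR_onem_cvg1.
      by rewrite subrr powR0 ?gt_eqF//; exact: powR_onem_cvg1.
  - move=> t t01; rewrite fE; last exact: subset_itv_oo_cc t01.
    move: t01; rewrite in_itv/= => /andP[t0 t1].
    have [d1 e1] := is_derive1_powR a t0.
    have [d2 e2] := is_derive_powR_onem b t1.
    rewrite derive1E deriveB//; last exact: derivableM.
    rewrite deriveM// e1 e2 /= /GRing.scale/=.
    by ring.
  by rewrite subrr subr0 powR1 powR0 ?gt_eqF//; ring.
have : \int[lebesgue_measure]_(t in `[0, 1]) f t =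
    a * eulerB a b -
    (a + b) * (\int[lebesgue_measure]_(t in `[0, 1]) (t * beta_weight a b t)) + 1.
  rewrite RintegralD// int_g; congr (_ + _).
  by rewrite RintegralB// !RintegralZl.
by rewrite int_f => ?; lra.
Qed.

(** A zero integral would make the nonnegative weight vanish almost everywhere, yet it is positive
    on ]0, 1[, a set of measure 1. *)
Lemma eulerB_gt0 a b : 0 < a -> 0 < b -> 0 < eulerB a b.
Proof.
move=> a0 b0; rewrite lt_def; apply/andP; split; last first.
  by apply: Rintegral_ge0 => t _; exact: beta_weight_ge0.
apply/eqP => B0.
have iw := beta_weight_integrable a0 b0.
have mw := measurable_int _ iw.
have : (\int[lebesgue_measure]_(t in `[0%R, 1%R]) `|(beta_weight a b t)%:E| = 0)%E.
  under eq_integral do rewrite gee0_abs ?lee_fin ?beta_weight_ge0//.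
  by rewrite -[LHS]fineK ?integrable_fin_num//; exact: (congr1 EFin B0).
move=> /(ae_eq_integral_abs _ m01 mw).1 [N [mN N0 sub]].
have : (lebesgue_measure `]0%R, 1%R[ <= lebesgue_measure N)%E.
  apply: le_measure; rewrite ?inE//.
  move=> t; rewrite /= in_itv/= => /andP[t0 t1]; apply: sub => /= H.
  have := H _; rewrite in_itv/= !ltW// => /(_ isT) [] /eqP.
  by rewrite mulf_eq0 !gt_eqF ?powR_gt0 ?subr_gt0.
by rewrite N0 lebesgue_measure_itv/= lte_fin ltr01 oppr0 adde0 lee_fin ler10.
Qed.

End beta_weight.

(** * Rising factorials *)

Section rising_factorial.
Variable R : realFieldType.
Implicit Types x : R.

(** The Pochhammer symbol x (x + 1) ... (x + j - 1). *)
Definition rising x j : R := \prod_(i < j) (x + i%:R).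

Lemma risingS x j : rising x j.+1 = (x + j%:R) * rising x j.
Proof. by rewrite /rising big_ord_recr mulrC. Qed.

Lemma rising0 x : rising x 0 = 1.
Proof. by rewrite /rising big_ord0. Qed.

Lemma rising_gt0 x j : 0 < x -> 0 < rising x j.
Proof. by move=> x0; apply: prodr_gt0 => i _; rewrite ltr_wpDr. Qed.

Lemma rising_zero j : rising 0 j = (j == 0)%:R.
Proof.
case: j => [|j]; first by rewrite rising0.
by rewrite /rising big_ord_recl add0r mul0r.
Qed.

End rising_factorial.

(** * Linearity of the functionals and their values on monomials *)

Section functionals.
Variable R : realType.
Implicit Types (f g : R -> R) (a b : R).

Let m01 : measurable (`[0, 1]%classic : set (measurableTypeR R)).
Proof. exact: measurable_itv. Qed.

Lemma beta_weight_shift a b j t : 0 < a -> 0 <= t ->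
  t ^+ j * beta_weight a b t = beta_weight (a + j%:R) b t.
Proof.
move=> a0 t0; elim: j => [|j IHj]; first by rewrite expr0 mul1r addr0.
have aj : 0 < a + j%:R by rewrite ltr_wpDr.
by rewrite exprS -mulrA IHj beta_weightX// /beta_weight -natr1 addrA addrK.
Qed.

(** Iterates (a + b) B(a + 1, b) = a B(a, b), which is the first moment identity. *)
Lemma eulerB_shift a b j : 0 < a -> 0 < b ->
  rising (a + b) j * eulerB (a + j%:R) b = rising a j * eulerB a b.
Proof.
move=> a0 b0; elim: j => [|j IHj]; first by rewrite !rising0 addr0.
have aj : 0 < a + j%:R by rewrite ltr_wpDr.
rewrite !risingS -[LHS]mulrA [LHS]mulrCA -[RHS]mulrA -IHj [RHS]mulrCA.
congr (_ * _); rewrite -beta_weight_first_moment// addrAC; congr (_ * _).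
apply: eq_Rintegral => t.
rewrite inE/= in_itv/= => /andP[t0 _].
by rewrite beta_weightX// -natr1 addrA addrK.
Qed.

(** A continuous function is bounded on the compact [0,1], and integrable times bounded is
    integrable. *)
Lemma beta_weightM_integrable a b f : 0 < a -> 0 < b ->
  {within `[0, 1], continuous f} ->
  lebesgue_measure.-integrable `[0, 1] (EFin \o (fun t => beta_weight a b t * f t)).
Proof.
move=> a0 b0 cf.
apply: (integrableMl m01 (beta_weight_integrable a0 b0)).
  exact: subspace_continuous_measurable_fun.
have /compact_bounded[M [_ fM]] := continuous_compact cf (@segment_compact R 0 1).
by exists M; split; rewrite ?num_real// => ? ? ? ?; exact: fM.
Qed.

Lemma continuous_within_horner (p : {poly R}) (A : set R) :
  {within A, continuous (horner p)}.
Proof. by apply: continuous_subspaceT; exact: continuous_horner. Qed.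

Variables (n : nat) (rho : R).
Hypothesis rho0 : 0 < rho.

Let Ffun_integrable k f : (0 < k < n)%N -> {within `[0, 1], continuous f} ->
  lebesgue_measure.-integrable `[0, 1] (EFin \o (fun t =>
    t `^ (k%:R * rho - 1) * (1 - t) `^ ((n - k)%:R * rho - 1)
      / eulerB (k%:R * rho) ((n - k)%:R * rho) * f t)).
Proof.
move=> /andP[k0 kn] cf.
have a0 : 0 < k%:R * rho by rewrite mulr_gt0// ltr0n.
have b0 : 0 < (n - k)%:R * rho by rewrite mulr_gt0// ltr0n subn_gt0.
have := integrableZl m01 (eulerB (k%:R * rho) ((n - k)%:R * rho))^-1
  (beta_weightM_integrable a0 b0 cf).
apply: eq_integrable => // t _ /=.
by rewrite -EFinM mulrA [X in X * _]mulrC.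
Qed.

Lemma FfunP k c f g : (k <= n)%N ->
  {within `[0, 1], continuous f} -> {within `[0, 1], continuous g} ->
  Ffun n rho k (fun x => c * f x + g x) = c * Ffun n rho k f + Ffun n rho k g.
Proof.
move=> kn cf cg; rewrite /Ffun; case: eqVneq => // k0; case: eqVneq => // kn'.
have kk : (0 < k < n)%N by rewrite lt0n k0 ltn_neqAle kn' kn.
rewrite -RintegralZl//; last exact: Ffun_integrable.
rewrite -RintegralD//; last 2 first.
- have := integrableZl m01 c (Ffun_integrable kk cf).
  by apply: eq_integrable => // t _ /=.
- exact: Ffun_integrable.
by apply: eq_Rintegral => t _; rewrite mulrDr mulrCA.
Qed.

(** For inner k, t^j is absorbed into the weight, leaving the quotient B(a + j, b) / B(a, b). The
    point evaluations fit the same formula: at k = 0 the numerator is 1 for j = 0 and 0 otherwise,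
    and at k = n the quotient is 1. *)
Lemma Ffun_monomial k j : (0 < n)%N -> (k <= n)%N ->
  Ffun n rho k (horner 'X^j) = rising (k%:R * rho) j / rising (n%:R * rho) j.
Proof.
move=> n0 kn; rewrite /Ffun.
have N0 : 0 < n%:R * rho by rewrite mulr_gt0// ltr0n.
have RN := rising_gt0 j N0.
case: eqVneq => [->|k0].
  rewrite mul0r rising_zero hornerXn expr0n; case: j RN => [|j] RN /=.
    by rewrite rising0 divr1.
  by rewrite mul0r.
case: eqVneq => [->|kn'].
  by rewrite hornerXn expr1n divff// gt_eqF.
have kk : (0 < k < n)%N by rewrite lt0n k0 ltn_neqAle kn' kn.
have [k0' kn''] := andP kk.
have a0 : 0 < k%:R * rho by rewrite mulr_gt0// ltr0n.
have b0 : 0 < (n - k)%:R * rho by rewrite mulr_gt0// ltr0n subn_gt0.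
set a := k%:R * rho; set b := (n - k)%:R * rho.
have abE : a + b = n%:R * rho by rewrite -mulrDl -natrD subnKC.
have B0 := eulerB_gt0 a0 b0.
apply: (@mulIf _ (rising (n%:R * rho) j)); first by rewrite gt_eqF.
rewrite divfK ?gt_eqF//.
transitivity ((eulerB a b)^-1 * eulerB (a + j%:R) b * rising (n%:R * rho) j).
  congr (_ * _); rewrite -RintegralZl//; last first.
    by apply: beta_weight_integrable => //; rewrite ltr_wpDr.
  apply: eq_Rintegral => t; rewrite inE/= in_itv/= => /andP[t0 _].
  have := beta_weight_shift b j a0 t0; rewrite /beta_weight -/a => <-.
  by rewrite hornerXn; ring.
rewrite -mulrA [X in _ * X]mulrC -abE eulerB_shift// mulrC mulfK//.
by rewrite gt_eqF.
Qed.

End functionals.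

(** * Linear operators triangular in the monomial basis *)

Section triangular_operator.
Variables (R : fieldType) (A : {linear {poly R} -> {poly R}}).
Variables (l : nat -> R) (n : nat).
Hypothesis A_triangular :
  forall d, (d <= n)%N -> (size (A 'X^d - l d *: 'X^d)%R <= d)%N.
Implicit Types p q r s : {poly R}.

Lemma size_sub_lead p d :
  (size p <= d.+1)%N -> (size (p - p`_d *: 'X^d)%R <= d)%N.
Proof.
move=> sp; apply/leq_sizeP => j; rewrite leq_eqVlt => /predU1P[<-|dj].
  by rewrite coefB coefZ coefXn eqxx mulr1 subrr.
rewrite coefB coefZ coefXn gtn_eqF// mulr0 subr0.
by move/leq_sizeP : sp; apply.
Qed.

Lemma size_polyD_leq p q d : (size p <= d)%N -> (size q <= d)%N -> (size (p + q)%R <= d)%N.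
Proof.
by move=> sp sq; rewrite (leq_trans (size_polyD _ _))// geq_max sp sq.
Qed.

Lemma size_triangular p d :
  (d <= n.+1)%N -> (size p <= d)%N -> (size (A p) <= d)%N.
Proof.
elim: d p => [|d IHd] p dn sp.
  by move: sp; rewrite leqn0 size_poly_eq0 => /eqP->; rewrite linear0 size_poly0.
rewrite -{1}[p](subrK (p`_d *: 'X^d)) linearD [A (_ *: _)]linearZ /=.
apply: size_polyD_leq.
  by apply: leqW; apply: IHd; [exact: ltnW|exact: size_sub_lead].
rewrite (leq_trans (size_scale_leq _ _))// -[A _](subrK (l d *: 'X^d)).
apply: size_polyD_leq; first by apply: leqW; exact: A_triangular.
by rewrite (leq_trans (size_scale_leq _ _))// size_polyXn.
Qed.

Lemma coef_triangular p d :
  (d <= n)%N -> (size p <= d.+1)%N -> (A p)`_d = l d * p`_d.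
Proof.
move=> dn sp; rewrite -{1}[p](subrK (p`_d *: 'X^d)) linearD [A (_ *: _)]linearZ coefD.
rewrite nth_default ?add0r; last first.
  by apply: size_triangular; [exact: leqW|exact: size_sub_lead].
rewrite coefZ -[A _](subrK (l d *: 'X^d)) coefD.
rewrite (nth_default _ (A_triangular dn)) add0r.
by rewrite coefZ coefXn eqxx mulr1 mulrC.
Qed.

(** Compare the leading coefficients of both sides of [A p = a *: p]. *)
Lemma triangular_eigenvalue p a :
  (size p <= n.+1)%N -> p != 0 -> A p = a *: p -> a = l (size p).-1.
Proof.
move=> sp p0 Ap; have sp0 : (0 < size p)%N by rewrite size_poly_gt0.
have : (A p)`_(size p).-1 = l (size p).-1 * p`_(size p).-1.
  by apply: coef_triangular; rewrite ?prednK// -ltnS prednK.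
rewrite Ap coefZ => /mulIf; apply.
by rewrite -lead_coefE lead_coef_eq0.
Qed.

(** Back substitution: A - a is triangular with nonzero diagonal entries l_j - a, so the top
    coefficient is solved first and the rest has smaller degree. *)
Lemma triangular_solve a d s : (d <= n.+1)%N ->
  (forall j, (j < d)%N -> l j != a) -> (size s <= d)%N ->
  exists2 r : {poly R}, (size r <= d)%N & A r - a *: r = s.
Proof.
move=> dn la; elim: d dn la s => [|d IHd] dn la s ss.
  exists 0; first by rewrite size_poly0.
  move: ss; rewrite leqn0 size_poly_eq0 => /eqP->.
  by rewrite linear0 scaler0 subr0.
pose r1 := (s`_d / (l d - a)) *: 'X^d : {poly R}.
have lda : l d - a != 0 by rewrite subr_eq0 la.
have sr1 : (size r1 <= d.+1)%N.
  by rewrite (leq_trans (size_scale_leq _ _))// size_polyXn.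
have sArd : (size (s - (A r1 - a *: r1))%R <= d)%N.
  (* The coefficient of [r1] is chosen so that the degree d terms cancel; what remains is two
     polynomials already known to have size at most d. *)
  have -> : s - (A r1 - a *: r1) =
      (s - s`_d *: 'X^d) - (s`_d / (l d - a)) *: (A 'X^d - l d *: 'X^d).
    rewrite /r1 [A (_ *: _)]linearZ /=; set k := s`_d / (l d - a).
    have -> : s`_d = k * (l d - a) by rewrite /k divfK.
    by rewrite -!mul_polyC polyCM polyCB; ring.
  apply: size_polyD_leq; first exact: size_sub_lead.
  rewrite size_polyN (leq_trans (size_scale_leq _ _))//.
  exact: A_triangular.
have [||r sr rE] := IHd _ _ _ sArd; first exact: ltnW.
  by move=> j jd; apply: la; exact: leqW.
exists (r1 + r); first by apply: size_polyD_leq => //; exact: leqW.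
by rewrite linearD scalerDr opprD addrACA rE addrC subrK.
Qed.

(** With the ansatz p = X^d + r, the eigenvalue equation becomes (A - l_d) r = l_d X^d - A X^d. The
    right side has degree below d, where A - l_d has nonzero diagonal. *)
Lemma triangular_eigenvector d : (d <= n)%N ->
  (forall j, (j < d)%N -> l j != l d) ->
  exists p, [/\ p \is monic, size p = d.+1 & A p = l d *: p].
Proof.
move=> dn ld.
have [|r sr rE] := triangular_solve (leqW dn) ld (s := l d *: 'X^d - A 'X^d).
  by rewrite -size_polyN opprB A_triangular.
have sp : size ('X^d + r) = d.+1 by rewrite size_polyDl size_polyXn.
exists ('X^d + r); split => //.
  by rewrite monicE lead_coefDl ?size_polyXn// lead_coefXn.
rewrite linearD scalerDr; apply/eqP.
by rewrite -subr_eq0 opprD addrACA rE addrC subrKA subrr.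
Qed.

Variable P : nat -> {poly R}.
Hypothesis P_eigen : forall d, (d <= n)%N ->
  [/\ P d \is monic, size (P d) = d.+1 & A (P d) = l d *: P d].

(** Each [P d] is monic of degree d, so subtracting p_d [P d] lowers the degree. *)
Lemma eigenbasis_decomp d p : (d <= n.+1)%N -> (size p <= d)%N ->
  exists c : nat -> R, p = \sum_(j < d) c j *: P j.
Proof.
elim: d p => [|d IHd] p dn sp.
  exists (fun=> 0); rewrite big_ord0; apply/eqP.
  by rewrite -size_poly_eq0 -leqn0.
have [mP sP _] := P_eigen dn.
have [|c cE] := IHd (p - p`_d *: P d) (ltnW dn).
  have := @size_sub_lead (p - p`_d *: P d) d.
  rewrite coefB coefZ.
  have -> : (P d)`_d = 1 by have := monicP mP; rewrite lead_coefE sP.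
  rewrite mulr1 subrr scale0r subr0; apply.
  apply: size_polyD_leq => //; rewrite size_polyN.
  by rewrite (leq_trans (size_scale_leq _ _))// sP.
exists (fun j => if j == d then p`_d else c j).
rewrite big_ord_recr /= eqxx -[LHS](subrK (p`_d *: P d)) cE; congr (_ + _).
by apply: eq_bigr => j _; rewrite ltn_eqF.
Qed.

Lemma iter_eigenbasis d (c : nat -> R) M : (d <= n.+1)%N ->
  iter M (fun q => q - A q) (\sum_(j < d) c j *: P j) =
  \sum_(j < d) (c j * (1 - l j) ^+ M) *: P j.
Proof.
move=> dn; elim: M => [|M IHM] /=.
  by apply: eq_bigr => j _; rewrite expr0 mulr1.
rewrite IHM linear_sum -sumrB; apply: eq_bigr => j _ /=.
have [|_ _ PE] := P_eigen (d := j); first by rewrite -ltnS (leq_trans _ dn).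
rewrite [A (_ *: _)]linearZ /= PE scalerA -scalerBl; congr (_ *: _).
by rewrite exprSr; ring.
Qed.

End triangular_operator.

(** * Bernstein sums of rising factorials *)

Section bernstein_sums.
Variables (R : realType) (n : nat).

(** At m = 0 the exponent [m.-1] is truncated to 0, but the multiplicity m makes both sides
    vanish. *)
Lemma mulr_expr_pred (x : {poly R}) m : x * (x ^+ m.-1 *+ m) = m%:R * x ^+ m.
Proof. by rewrite mulrnAr mulr_natl; case: m => [|m] /=; rewrite ?mulr0n// -exprS. Qed.

(** The identity x (1 - x) p' = (k - n x) p turns multiplication by the index k into a differential
    operator that does not depend on k. *)
Lemma deriv_bern k : (k <= n)%N ->
  'X * (1 - 'X) * (bern n k)^`() =
    k%:R *: bern n k - n%:R *: ('X * bern n k) :> {poly R}.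
Proof.
move=> kn; rewrite /bern derivZ -scalerAr -[in RHS]scalerAr.
rewrite ![_%:R *: ('C(n, k)%:R *: _)]scalerA ![_%:R * 'C(n, k)%:R]mulrC.
rewrite -!scalerA -scalerBr; congr (_ *: _).
rewrite -!mul_polyC !polyC_natr.
have -> : n%:R = k%:R + (n - k)%:R :> {poly R} by rewrite -natrD subnKC.
rewrite derivM derivXn deriv_exp derivB derivX derivC sub0r mulN1r mulNrn mulrN.
have := mulr_expr_pred 'X k; have := mulr_expr_pred (1 - 'X) (n - k).
(* Once the powers are generalized, only the two relations [hu] and [hv] between them and
   commutative ring algebra are needed. *)
move: ('X^(k.-1) *+ k) ((1 - 'X) ^+ (n - k).-1 *+ (n - k)) => u v.
move: ('X^k) ((1 - 'X) ^+ (n - k)) => p q hv hu.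
transitivity ((1 - 'X) * q * ('X * u) - 'X * p * ((1 - 'X) * v)); first by ring.
by rewrite hu hv; ring.
Qed.

Lemma sum_bern : \sum_(k < n.+1) bern n k = 1 :> {poly R}.
Proof.
rewrite -[RHS](expr1n _ n) -{1}[1 in RHS](subrK 'X) exprDn.
apply: eq_bigr => k _; rewrite /bern scaler_nat mulrC.
by [].
Qed.

Variable rho : R.

(** By the values on monomials, this is U e_j multiplied by the rising factorial of n rho. *)
Definition bern_rising j : {poly R} :=
  \sum_(k < n.+1) rising (k%:R * rho) j *: bern n k.

Lemma bern_rising0 : bern_rising 0 = 1.
Proof.
rewrite -sum_bern; apply: eq_bigr => k _.
by rewrite rising0 scale1r.
Qed.

(** The new factor k rho + j splits into j, a scalar, and k rho, where k is expressed through the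
    derivative of the Bernstein polynomial. *)
Lemma bern_risingS j : bern_rising j.+1 =
  rho *: ('X * (1 - 'X) * (bern_rising j)^`() + n%:R *: ('X * bern_rising j)) +
  j%:R *: bern_rising j.
Proof.
rewrite /bern_rising raddf_sum /= !mulr_sumr !scaler_sumr -big_split /=.
rewrite scaler_sumr -big_split /=; apply: eq_bigr => k _.
rewrite derivZ -scalerAr deriv_bern; last by rewrite -ltnS.
rewrite risingS -!mul_polyC !rmorphM /= !rmorphD /= !rmorphM /=.
ring.
Qed.

(** Degree and leading coefficient both follow from this recursion by induction on j. *)
Lemma coef_bern_risingS j i : (bern_rising j.+1)`_i.+1 =
  (rho * i.+1%:R + j%:R) * (bern_rising j)`_i.+1 +
  rho * (n%:R - i%:R) * (bern_rising j)`_i.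
Proof.
rewrite bern_risingS coefD !coefZ coefD coefZ coefXM /=.
have -> : ('X * (1 - 'X) * (bern_rising j)^`())`_i.+1 =
    (bern_rising j)`_i.+1 * i.+1%:R - (bern_rising j)`_i * i%:R.
  rewrite mulrBr mulr1 mulrBl coefB -mulrA !coefXM /= coef_deriv mulr_natr.
  case: i => [|i] /=; first by rewrite mulr0 subr0.
  by rewrite coef_deriv mulr_natr.
ring.
Qed.

Lemma size_bern_rising j : (size (bern_rising j) <= j.+1)%N.
Proof.
elim: j => [|j IHj]; first by rewrite bern_rising0 size_poly1.
apply/leq_sizeP => -[//|i] ji; rewrite coef_bern_risingS.
by move/leq_sizeP : IHj => h; rewrite !h ?mulr0 ?addr0// ltnW.
Qed.

Lemma lead_bern_rising j :
  (bern_rising j)`_j = \prod_(i < j) (rho * (n%:R - i%:R)).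
Proof.
elim: j => [|j IHj]; first by rewrite bern_rising0 big_ord0 coef1.
rewrite coef_bern_risingS big_ord_recr /= IHj nth_default ?size_bern_rising//.
by rewrite mulr0 add0r mulrC.
Qed.

Lemma bern_rising1 : bern_rising 1 = (rho * n%:R) *: 'X.
Proof.
by rewrite bern_risingS bern_rising0 derivC mulr0 add0r mulr1 scale0r addr0 scalerA.
Qed.

End bernstein_sums.

(** * The eigenvalues and their order *)

Section eigenvalues.
Variables (R : realType) (n : nat) (rho : R).
Hypothesis rho0 : 0 < rho.

(** The leading coefficient of [bern_rising n rho j] divided by the rising factorial of n rho,
    paired factor by factor. *)
Definition Ueigval j : R :=
  \prod_(i < j) (rho * (n%:R - i%:R) / (n%:R * rho + i%:R)).

Lemma Ueigval0 : Ueigval 0 = 1.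
Proof. by rewrite /Ueigval big_ord0. Qed.

Lemma Ueigval1 : (0 < n)%N -> Ueigval 1 = 1.
Proof.
move=> n0; rewrite /Ueigval big_ord1 subr0 addr0 [rho * _]mulrC divff//.
by rewrite mulf_neq0 ?gt_eqF// ltr0n.
Qed.

Lemma Ueigval_gt0 j : (j <= n)%N -> 0 < Ueigval j.
Proof.
move=> jn; apply: prodr_gt0 => i _.
have ni : (i < n)%N by rewrite (leq_trans _ jn).
rewrite divr_gt0// ?mulr_gt0// ?subr_gt0 ?ltr_nat//.
by rewrite ltr_pwDl// mulr_gt0// ltr0n (leq_ltn_trans _ ni).
Qed.

(** The factor of index j is below 1, since its denominator exceeds its numerator by j (1 + rho). At
    j = 0 they agree, which is why the first two eigenvalues coincide. *)
Lemma UeigvalS_lt j : (0 < j)%N -> (j < n)%N -> Ueigval j.+1 < Ueigval j.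
Proof.
move=> j0 jn; rewrite /Ueigval big_ord_recr /= -[ltRHS]mulr1.
rewrite ltr_pM2l; last exact: (Ueigval_gt0 (ltnW jn)).
have nj : 0 < n%:R * rho + j%:R.
  by rewrite ltr_wpDl ?ltr0n// mulr_ge0// ltW.
rewrite ltr_pdivrMr// mul1r mulrBr mulrC -subr_gt0.
have -> : n%:R * rho + j%:R - (n%:R * rho - rho * j%:R) = j%:R + rho * j%:R by ring.
by rewrite addr_gt0 ?mulr_gt0 ?ltr0n.
Qed.

Lemma Ueigval_lt i j : (0 < i)%N -> (i < j)%N -> (j <= n)%N -> Ueigval j < Ueigval i.
Proof.
move=> i0; elim: j => // j IHj; rewrite ltnS leq_eqVlt => /predU1P[<-|ij] jn.
  exact: UeigvalS_lt.
by apply: lt_trans (IHj ij (ltnW jn)); apply: UeigvalS_lt => //; exact: ltn_trans ij.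
Qed.

Lemma Ueigval_le i j : (i <= j)%N -> (j <= n)%N -> Ueigval j <= Ueigval i.
Proof.
rewrite leq_eqVlt => /predU1P[->//|ij] jn.
case: i ij => [|i] ij; last by rewrite ltW// Ueigval_lt.
have n0 : (0 < n)%N by exact: leq_trans jn.
rewrite Ueigval0 -(Ueigval1 n0); case: j ij jn => [//|[//|j]] _ jn.
by rewrite ltW// Ueigval_lt.
Qed.

End eigenvalues.

(** * The operator on polynomials: spectrum, inverse, eigenpolynomial *)

Section U_operator.
Variables (R : realType) (n : nat) (rho : R).
Hypothesis rho0 : 0 < rho.
Hypothesis n0 : (0 < n)%N.

Lemma UopP c (f g : R -> R) :
  {within `[0, 1], continuous f} -> {within `[0, 1], continuous g} ->
  Uop n rho (fun x => c * f x + g x) = c *: Uop n rho f + Uop n rho g.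
Proof.
move=> cf cg; apply: val_inj; rewrite /= !UopE scaler_sumr -big_split /=.
apply: eq_bigr => k _; rewrite FfunP//; last by rewrite -ltnS.
by rewrite scalerDl -scalerA.
Qed.

Definition Upoly (p : {poly R}) : {poly R} := Uop n rho (horner p).

Lemma Upoly_is_linear : linear Upoly.
Proof.
move=> c p q; rewrite /Upoly.
have -> : horner (c *: p + q) = fun x => c * p.[x] + q.[x].
  by apply/funext => x; rewrite hornerD hornerZ.
rewrite UopP; [by []|exact: continuous_within_horner..].
Qed.

(** Acting on all of [{poly R}], without a degree bound in the type, it is an instance of the
    triangular operators above. *)
Definition Ulin : {linear {poly R} -> {poly R}} :=
  HB.pack Upoly (GRing.isLinear.Build R _ _ _ Upoly Upoly_is_linear).

Lemma Ulin_monomial j : Ulin 'X^j = (rising (n%:R * rho) j)^-1 *: bern_rising n rho j.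
Proof.
rewrite /= /Upoly UopE /bern_rising scaler_sumr; apply: eq_bigr => k _.
by rewrite Ffun_monomial -1?ltnS// [_ / _]mulrC -scalerA.
Qed.

Lemma Ulin_triangular d : (d <= n)%N ->
  (size (Ulin 'X^d - Ueigval n rho d *: 'X^d)%R <= d)%N.
Proof.
move=> _; rewrite Ulin_monomial; apply/leq_sizeP => j.
rewrite coefB !coefZ coefXn leq_eqVlt => /predU1P[<-|dj].
  rewrite eqxx mulr1 lead_bern_rising /rising -prodfV -big_split /=.
  by apply/eqP; rewrite subr_eq0; apply/eqP/eq_bigr => i _; rewrite mulrC.
rewrite gtn_eqF// mulr0 subr0 nth_default ?mulr0//.
exact: leq_trans (size_bern_rising _ _ _) dj.
Qed.

(** The double eigenvalue 1 rules out the general construction at degree 1, so e_0 and e_1 are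
    checked directly. From degree 2 on, the eigenvalue differs from all earlier ones. *)
Lemma Ueigval_eigenvector d : (d <= n)%N ->
  exists p, [/\ p \is monic, size p = d.+1 & Ulin p = Ueigval n rho d *: p].
Proof.
case: d => [|[|d]] dn.
- exists 1; split; [exact: monic1|exact: size_poly1|].
  rewrite Ueigval0 scale1r -[1 in LHS](expr0 'X).
  by rewrite Ulin_monomial rising0 invr1 scale1r bern_rising0.
- exists 'X; split; [exact: monicX|exact: size_polyX|].
  rewrite -[X in Ulin X]expr1 Ulin_monomial bern_rising1 scalerA Ueigval1//.
  rewrite risingS rising0 addr0 mulr1 [rho * _]mulrC mulVf//.
  by rewrite mulf_neq0 ?gt_eqF ?ltr0n.
- apply: (triangular_eigenvector Ulin_triangular dn) => j jd.
  case: j jd => [|j] jd.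
    by rewrite Ueigval0 -(Ueigval1 rho0 n0) gt_eqF// Ueigval_lt.
  by rewrite gt_eqF// Ueigval_lt.
Qed.

(** [linfun] is known to agree with its argument once that is packed as a linear map. *)
Lemma UPiE (p : {poly_n.+1 R}) : UPi n rho p = Uop n rho (horner p).
Proof.
pose g (q : {poly_n.+1 R}) := Uop n rho (horner q).
have glin : linear g.
  by move=> c q r; apply: val_inj; exact: (Upoly_is_linear c q r).
pose gL : {linear {poly_n.+1 R} -> {poly_n.+1 R}} :=
  HB.pack g (GRing.isLinear.Build R _ _ _ g glin).
exact: (lfunE gL p).
Qed.

Lemma UPi_Ulin (p : {poly_n.+1 R}) : UPi n rho p = Ulin p :> {poly R}.
Proof. by rewrite UPiE. Qed.

(** Injectivity makes the formal inverse in [Lop] a true one. A nonzero kernel element would be an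
    eigenvector for 0, but all eigenvalues are positive. *)
Lemma UPi_lker0 : lker (UPi n rho) == 0%VS.
Proof.
rewrite -subv0; apply/subvP => p; rewrite memv_ker memv0 => /eqP Up.
apply/eqP/val_inj => /=; apply/eqP/negPn/negP => p0.
have : Ulin p = 0 *: (p : {poly R}) by rewrite -UPi_Ulin Up scale0r.
move=> /(triangular_eigenvalue Ulin_triangular (size_npoly p) p0)/esym.
apply/eqP; rewrite gt_eqF// Ueigval_gt0//.
by rewrite -ltnS prednK ?size_npoly// size_poly_gt0.
Qed.

Lemma UPi_mxE (i j : 'I_n.+1) : UPi_mx n rho i j = (Ulin 'X^i)`_j.
Proof.
rewrite mxE npolyX_coords UPi_Ulin; congr (_`_j); congr (Ulin _).
by rewrite (tnth_nth 0) nth_npolyX npolyXE.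
Qed.

(** The matrix is lower triangular with the [Ueigval] on its diagonal, which gives the
    characteristic polynomial. Unique factorization fixes the roots up to order, and sorting fixes
    the order, so [xget] has a single candidate. *)
Lemma eigvalsE : eigvals n rho = mkseq (Ueigval n rho) n.+1.
Proof.
have ssorted : sorted >=%R (mkseq (Ueigval n rho) n.+1).
  apply/(sortedP 0) => i; rewrite size_mkseq => iln.
  rewrite !nth_mkseq//; last exact: ltnW.
  exact: Ueigval_le.
have char : char_poly (UPi_mx n rho) =
    \prod_(a <- mkseq (Ueigval n rho) n.+1) ('X - a%:P).
  rewrite char_poly_trig; last first.
    apply/is_trig_mxP => i j ij; rewrite UPi_mxE nth_default//.
    apply: leq_trans ij; apply: (size_triangular Ulin_triangular) => //.
    by rewrite size_polyXn.
  rewrite big_map -[iota 0 n.+1]/(index_iota 0 n.+1) big_mkord.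
  apply: eq_bigr => i _; rewrite UPi_mxE.
  rewrite (coef_triangular Ulin_triangular) ?size_polyXn// -1?ltnS//.
  by rewrite coefXn eqxx mulr1.
apply: xget_unique => // s [ss sE].
have ge_trans : transitive (>=%R : rel R) by move=> x y z yx zx; exact: le_trans zx yx.
have ge_anti : antisymmetric (>=%R : rel R).
  by move=> x y /andP[/= yx xy]; apply: le_anti; rewrite xy yx.
apply: (sorted_eq ge_trans ge_anti) => //.
by apply: prod_XsubC_eq; rewrite -sE.
Qed.

Lemma lambdaE j : (j <= n)%N -> lambda n rho j = Ueigval n rho j.
Proof. by move=> jn; rewrite /lambda eigvalsE nth_mkseq. Qed.

Lemma Ueigval_min j : (1 < n)%N -> (j < n)%N -> Ueigval n rho n < Ueigval n rho j.
Proof.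
move=> n1; case: j => [_|j jn]; last exact: Ueigval_lt.
by rewrite Ueigval0 -(Ueigval1 rho0 n0) Ueigval_lt.
Qed.

(** The difference of two monic candidates has degree below n. If nonzero, it would be an
    eigenvector for l_n, whereas every such eigenvector has degree n. *)
Lemma eigpoly_unique (p : {poly R}) : (1 < n)%N ->
  p \is monic -> size p = n.+1 -> Ulin p = Ueigval n rho n *: p ->
  eigpoly n rho = p :> {poly R}.
Proof.
move=> n1 mp sp Up.
have pK : npolyp n.+1 p = p :> {poly R} by rewrite npolypK ?sp.
have eigP (q : {poly_n.+1 R}) :
    (q \in passmx.leigenspace (UPi n rho) (lambda n rho n)) =
    (Ulin q == Ueigval n rho n *: (q : {poly R})).
  rewrite memv_ker add_lfunE opp_lfunE scale_lfunE id_lfunE lambdaE// subr_eq0.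
  by rewrite -val_eqE /= UPi_Ulin.
(* An eigenvector of degree d has eigenvalue l_d, and l_d > l_n for d < n. *)
have size_eig (q : {poly R}) : (size q <= n.+1)%N -> q != 0 ->
    Ulin q = Ueigval n rho n *: q -> (size q).-1 = n.
  move=> sq q0 /(triangular_eigenvalue Ulin_triangular sq q0).
  have : ((size q).-1 <= n)%N by rewrite -ltnS prednK// size_poly_gt0.
  rewrite leq_eqVlt => /predU1P[//|qn] qE; exfalso; move: qE; apply/eqP.
  by rewrite lt_eqF// Ueigval_min.
rewrite /eigpoly (@xget_unique _ 0 _ (npolyp n.+1 p)) //.
  by split; rewrite ?eigP pK ?Up.
move=> q []; rewrite eigP => /eqP Uq mq.
apply: val_inj => /=; rewrite pK; apply/eqP; rewrite -subr_eq0.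
apply/negPn/negP => qp0.
have sq : size q = n.+1.
  have q0 := monic_neq0 mq.
  have := congr1 succn (size_eig _ (size_npoly q) q0 Uq).
  by rewrite prednK// size_poly_gt0.
have spq : (size (val q - p)%R <= n)%N.
  apply/leq_sizeP => j; rewrite leq_eqVlt coefB => /predU1P[<-|nj].
    have := monicP mq; have := monicP mp; rewrite !lead_coefE sp sq => -> /= ->.
    by rewrite subrr.
  by rewrite !nth_default ?subrr// ?sp ?sq.
have := size_eig _ (leqW spq) qp0.
rewrite linearB Up Uq scalerBr => /(_ erefl) h.
have : (n < size (val q - p)%R)%N by rewrite -[X in (X < _)%N]h prednK// size_poly_gt0.
by rewrite ltnNge spq.
Qed.

End U_operator.

(** * Uniform convergence of the iterated Boolean sums *)

Lemma horner_bound01 (R : realFieldType) (p : {poly R}) x :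
  0 <= x <= 1 -> `|p.[x]| <= \sum_(i < size p) `|p`_i|.
Proof.
move=> /andP[x0 x1]; rewrite horner_coef; apply: le_trans (ler_norm_sum _ _ _) _.
apply: ler_sum => i _; rewrite normrM ler_piMr// normrX.
by rewrite exprn_ile1 ?ger0_norm.
Qed.

Lemma uniform_cvg_dominated (R : realType) (A : set R) (F : nat -> R -> R)
    (g : R -> R) (u : nat -> R) :
  (forall M x, A x -> `|g x - F M x| <= u M) -> u @ \oo --> 0 ->
  {uniform A, F @ \oo --> g}.
Proof.
move=> Fu u0 Q /uniform_nbhs[E []].
rewrite -entourage_ballE => -[e /= e0 eE] EQ.
have /cvgrPdist_lt/(_ _ e0) := u0.
apply: filterS => M uM; apply: EQ => x Ax; apply: eE.
apply: le_lt_trans (Fu M x Ax) _.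
by apply: le_lt_trans uM; rewrite sub0r normrN ler_norm.
Qed.

(** As U f = U p, the part f - p is annihilated by U and hence fixed by I - U; only the polynomial
    part p evolves under iteration. *)
Lemma iter_defect (R : realType) (n : nat) (rho : R) (rho0 : 0 < rho)
    (f : R -> R) (p : {poly R}) M :
  {within `[0, 1], continuous f} -> Uop n rho f = Ulin n rho0 p :> {poly R} ->
  iter M (fun g y => g y - (Uop n rho g).[y]) f =
  fun x => f x - p.[x] + (iter M (fun q => q - Ulin n rho0 q) p).[x].
Proof.
move=> cf Uf; elim: M => [|M IHM] /=.
  by apply/funext => x; rewrite subrK.
rewrite IHM; set q := iter M _ p.
(* Regrouped as f plus a polynomial, which is the shape [UopP] accepts. *)
have -> : (fun x => f x - p.[x] + q.[x]) = fun x => 1 * f x + (q - p).[x].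
  by apply/funext => x; rewrite mul1r hornerD hornerN addrAC -addrA addrA.
rewrite UopP//; last exact: continuous_within_horner.
apply/funext => x; rewrite /= hornerD scale1r Uf -/(Upoly n rho (q - p)).
rewrite -[Upoly _ _ _]/(Ulin n rho0 (q - p)) linearB !(hornerD, hornerN) /=.
by ring.
Qed.

Theorem theorem3p1 (R : realType) (rho : R) (n : nat) (f : R -> R)
  (hrho : 0 < rho) (hn : (2 <= n)%N)
  (hf : {within `[0, 1], continuous f}) :
  {uniform `[0, 1],
    (fun (M : nat) (x : R) =>
       (1 - lambda n rho n) ^- M *
       (boolean_sum M (fun g => horner (Uop n rho g)) f x - (Lop n rho f).[x]))
    @ \oo --> (fun x : R => - divdiff n rho f * (eigpoly n rho).[x])}.
Proof.
have n0 : (0 < n)%N by exact: ltnW.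
(* Choice collects the eigenpolynomials into one family; the value 0 beyond degree n is a
   placeholder. *)
have [P PE] : {P : nat -> {poly R} & forall d, (d <= n)%N ->
    [/\ P d \is monic, size (P d) = d.+1 &
        Ulin n hrho (P d) = Ueigval n rho d *: P d]}.
  apply: (choice (P := fun d p => (d <= n)%N -> [/\ p \is monic, size p = d.+1 &
    Ulin n hrho p = Ueigval n rho d *: p])) => d.
  have [/(Ueigval_eigenvector hrho n0)[p ?]|_] := boolP (d <= n)%N.
    by exists p.
  by exists 0.
have [mP sP UP] := PE n (leqnn n).
set L := Lop n rho f.
have UL : Uop n rho f = Ulin n hrho L :> {poly R}.
  by rewrite -UPi_Ulin /L /Lop lker0_lfunVK// UPi_lker0.
have [c Lc] := eigenbasis_decomp PE (leqnn _) (size_npoly L).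
(* Only the monic [P n] contributes to the coefficient of e_n. *)
have cn : c n = divdiff n rho f.
  rewrite /divdiff -/L Lc big_ord_recr /= coefD coef_sum big1 ?add0r => [|j _].
    by rewrite coefZ -[n in _`_n]/(n.+1.-1) -sP -lead_coefE (monicP mP) mulr1.
  have [_ sPj _] := PE j (ltnW (ltn_ord j)).
  by rewrite coefZ nth_default ?mulr0// sPj.
rewrite (eigpoly_unique n0 hn mP sP UP) lambdaE//.
set l := Ueigval n rho; set mu := 1 - l n.
have mu0 : 0 < mu by rewrite subr_gt0 -(Ueigval0 n rho) Ueigval_min.
(* These are the ratios left after dividing by (1 - l_n)^M; they lie in [0, 1) for j < n. *)
pose r (j : nat) := (1 - l j) / mu.
have r_ge0 j : (j <= n)%N -> 0 <= r j.
  move=> jn; rewrite divr_ge0 ?(ltW mu0)// subr_ge0 -(Ueigval0 n rho).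
  exact: Ueigval_le.
have r_lt1 j : (j < n)%N -> r j < 1.
  move=> jn; rewrite ltr_pdivrMr// mul1r ltrD2l ltrN2.
  exact: Ueigval_min.
(* A bound for |[P j]| on [0,1] that does not depend on the point. *)
pose K j := \sum_(i < size (P j)) `|(P j)`_i|.
apply: (@uniform_cvg_dominated _ _ _ _
  (fun M => \sum_(j < n) `|c j| * K j * r j ^+ M)).
  move=> M x; rewrite /= in_itv/= => x01.
  rewrite /boolean_sum (iter_defect M hf UL) [in iter _ _ _]Lc.
  rewrite (iter_eigenbasis PE)// big_ord_recr /= hornerD hornerZ horner_sum cn.
  set S := \sum_(j < n) _.
  (* The terms in f and L cancel, and the [P n] component equals the limit exactly for every M, so
     the error consists of the components j < n. *)
  have -> : - divdiff n rho f * (P n).[x] - mu ^- M *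
      (f x - (f x - L.[x] + (S + divdiff n rho f * mu ^+ M * (P n).[x])) - L.[x]) =
      mu ^- M * S.
    have muM : mu ^+ M != 0 by rewrite expf_neq0// gt_eqF.
    by field.
  rewrite mulr_sumr; apply: le_trans (ler_norm_sum _ _ _) _.
  apply: ler_sum => j _; rewrite hornerZ.
  have -> : mu ^- M * (c j * (1 - l j) ^+ M * (P j).[x]) =
      c j * (P j).[x] * r j ^+ M.
    by rewrite /r expr_div_n; ring.
  rewrite !normrM normrX [`|r j|]ger0_norm ?r_ge0 1?ltnW//.
  rewrite ler_wpM2r ?exprn_ge0 ?r_ge0 1?ltnW//.
  by rewrite ler_wpM2l ?horner_bound01.
have sum0 : \sum_(j < n) `|c j| * K j * 0 = 0 by rewrite big1// => j _; rewrite mulr0.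
(* The majorant is a finite sum of geometric sequences with ratios in [0, 1). *)
rewrite -[X in _ --> X]sum0; apply: (cvg_big (F := \oo) (@add_continuous R)) => j _.
apply: cvgMl_tmp. apply: cvg_expr.
by rewrite ger0_norm ?r_ge0 ?r_lt1// ltnW.
Qed.
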